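(* Let $Z$ be a continuous random variable with CDF $F$ and density $f$ bounded by $L$, whose support is contained in $[0,1]$ with $\sup\{z : F(z)=0\} = 0$ and $\inf\{z : F(z)=1\} = 1$; define $F^{-1}(y) = \inf\{z : F(z) = y\}$. Let $\eta>0$ and run GBPA with the stochastically smoothed potential $\tilde\Phi$ whose perturbation is $\eta Z$. Then for every gain sequence $g_1,\dots,g_T\in[-1,0]^N$, every round $t$, and every $\epsilon\in(0,1)$, $$\mathbb{E}\big[D_{\tilde\Phi}(\hat G_t,\hat G_{t-1}) \,\big|\, i_1,\dots,i_{t-1}\big] \le NL\Big(\frac{1}{2\eta\epsilon} + 1 - F^{-1}(1-\epsilon)\Big).$$
   Context: Adversarial multi-armed bandit: $N$ arms, $T$ rounds; an oblivious adversary fixes $g_1,\dots,g_T \in [-1,0]^N$ in advance. For a random variable $W$ with a continuous distribution and finite expectation, the stochastically smoothed potential is $\tilde\Phi(G) = \mathbb{E}[\max_{i}(G_i + W_i)]$ for $G\in\mathbb{R}^N$, $W_1,\dots,W_N$ i.i.d. copies of $W$; it is convex and differentiable, $\nabla_i\tilde\Phi(G) = \mathbb{P}(i = \arg\max_j (G_j+W_j))$. ''Perturbation $\eta Z$'' means $W=\eta Z$. GBPA$(\tilde\Phi)$: $\hat G_0 = 0$; for $t=1,\dots,T$: $p_t = \nabla\tilde\Phi(\hat G_{t-1})$, draw $i_t \sim p_t$, observe only $g_{t,i_t}$, set $\hat g_t = \frac{g_{t,i_t}}{p_{t,i_t}} e_{i_t}$, $\hat G_t = \hat G_{t-1} + \hat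 g_t$. Bregman divergence: $D_{\tilde\Phi}(x,y) = \tilde\Phi(x)-\tilde\Phi(y)-\langle\nabla\tilde\Phi(y), x-y\rangle$. *)

(* Defs.v *)
From HB Require Import structures.
From mathcomp Require Import all_boot all_order all_algebra.
From mathcomp Require Import all_classical all_reals all_analysis.
Set Implicit Arguments. Unset Strict Implicit. Unset Printing Implicit Defensive.
Import Order.TTheory GRing.Theory Num.Theory.
Import numFieldNormedType.Exports.
Local Open Scope classical_set_scope.
Local Open Scope ring_scope.

(* Mutual independence of a finite family of real random variables:
   the product rule for every choice of measurable sets (taking A i = setT
   recovers the product rule for every subfamily). *)
Definition mutually_independent d (T : measurableType d) (R : realType)
  (P : probability T R) (N : nat) (W : 'I_N -> {RV P >-> R}) : Prop :=
  forall A : 'I_N -> set R, (forall i, measurable (A i)) ->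
    P (\bigcap_(i in [set: 'I_N]) (W i @^-1` A i)) =
    (\prod_(i < N) P (W i @^-1` A i))%E.

Definition smoothed_pot d (T : measurableType d) (R : realType)
  (P : probability T R) (N : nat) (W : 'I_N -> T -> R) (G : 'I_N -> R) : R :=
  fine (\int[P]_w (\big[maxe/-oo%E]_(i < N) ((G i + W i w)%:E)))%E.

Definition grad (R : realType) (N : nat) (Phi : ('I_N -> R) -> R)
  (G : 'I_N -> R) (i : 'I_N) : R :=
  derive1 (fun h : R => Phi (fun j => G j + (if j == i then h else 0))) 0.

Definition bregman (R : realType) (N : nat) (Phi : ('I_N -> R) -> R)
  (x y : 'I_N -> R) : R :=
  Phi x - Phi y - \sum_(i < N) grad Phi y i * (x i - y i).

(* One GBPA update: from G = \hat G_{t-1}, with the round-t gain vector gt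
   and the drawn arm i, returns \hat G_t = G + (gt i / p_{t,i}) e_i
   where p_t = grad Phi G. *)
Definition gbpa_step (R : realType) (N : nat) (Phi : ('I_N -> R) -> R)
  (gt : 'I_N -> R) (G : 'I_N -> R) (i : 'I_N) : 'I_N -> R :=
  fun j => G j + (if j == i then gt i / grad Phi G i else 0).

(* \hat G_k along the arm history (arm s = i_s for s >= 1). *)
Fixpoint gbpa_est (R : realType) (N : nat) (Phi : ('I_N -> R) -> R)
  (g : nat -> 'I_N -> R) (arm : nat -> 'I_N) (k : nat) : 'I_N -> R :=
  match k with
  | 0 => fun _ => 0
  | k'.+1 => gbpa_step Phi (g k) (gbpa_est Phi g arm k') (arm k)
  end.

(* The history i_1..i_{t-1} has positive probability under GBPA. *)
Definition history_pos (R : realType) (N : nat) (Phi : ('I_N -> R) -> R)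
  (g : nat -> 'I_N -> R) (arm : nat -> 'I_N) (t : nat) : Prop :=
  forall s : nat, (0 < s < t)%N ->
    0 < grad Phi (gbpa_est Phi g arm s.-1) (arm s).

(* E[ D_Phi(\hat G_t, \hat G_{t-1}) | i_1, ..., i_{t-1} ]:
   given the history, i_t ~ p_t = grad Phi (\hat G_{t-1}). *)
Definition cond_exp_bregman (R : realType) (N : nat) (Phi : ('I_N -> R) -> R)
  (g : nat -> 'I_N -> R) (arm : nat -> 'I_N) (t : nat) : R :=
  let G := gbpa_est Phi g arm t.-1 in
  \sum_(i < N) grad Phi G i * bregman Phi (gbpa_step Phi (g t) G i) G.

(* Main.v *)
Require Import Defs.
From HB Require Import structures.
From mathcomp Require Import all_boot all_order all_algebra.
From mathcomp Require Import all_classical all_reals all_analysis.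
From mathcomp Require Import measurable_realfun ring lra.
Import Order.TTheory GRing.Theory Num.Theory.
Import numFieldNormedType.Exports.
Local Open Scope classical_set_scope.
Local Open Scope ring_scope.

                                                                             
                                                                            
                                                                              
                                                                           
                                  
                                                                            
                                                               
                                         
                                                                     
                                  
                                                                            

(** Fix an arm [i], put [V = G i + eta * W i], and let [M] be the largest of the other perturbed
    gains. [V] and [M] are independent, [V] has density at most [lam = L / eta], and along
    coordinate i the potential is E max(V + h, M), with derivative p = P(V > M) at h = 0
    ([smooth_max_expansion], [grad_pot]). Playing arm [i] lowers its coordinate by s = -g/p, and
    with X = V - M the divergence is E[1{X > 0} (s - X)^+].

    Split this expectation at the threshold Q = G i + eta q, where q = F^{-1}(1 - eps). On M < Q the
    density bound gives at most lam s^2 / 2 times P(M < Q) ([excess_le]), and P(M < Q) is at most p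
    / eps, because V >= Q > M is a win for arm [i] and V >= Q has probability at least eps
    ([win_prob_ge]). On M >= Q a win forces V > Q, so this part is at most s P(W i > q), hence at
    most s L (1 - q) because the perturbation lives on [0,1]. Weighting by p and using 0 <= s p = -g
    <= 1 leaves L / (2 eta eps) + L (1 - q) per arm ([gbpa_arm_le]), and the sum over arms gives the
    factor N.

    Instead of conditioning on [M], [slab_le] cuts the range of [M] into small cells, uses
    independence on each cell, and lets the mesh tend to zero. *)

(** Used to let the mesh of a discretisation into n + 1 cells tend to zero, when its error is of
    order 1/(n + 1). *)
Lemma le_limit_harmonic (R : realType) (x y C : R) :
  (forall n : nat, x <= y + C / n.+1%:R) -> x <= y.
Proof.
move=> H; apply/ler_addgt0Pr => e e0.
have [C0|C0] := leP C 0.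
  apply: le_trans (H 0) _; rewrite divr1 lerD2l; lra.
have /archi_boundP : 0 <= C / e by rewrite divr_ge0 // ltW.
set n := Num.bound _ => Hn.
apply: le_trans (H n) _; rewrite lerD2l ler_pdivrMr ?ltr0Sn //.
rewrite mulrC -ler_pdivrMr //; apply: ltW; apply: lt_trans Hn _.
by rewrite ltr_nat.
Qed.

(** * Integrals of bounded measurable functions *)

Section BoundedMeasurable.
Context {R : realType} {d : measure_display} {T : measurableType d}.
Variable P : probability T R.

(** A class of integrable functions closed under the operations needed here, so that integrability
    goals are settled by proof search. Events enter as 0/1-valued factors [(b w)%:R]. *)
Definition bmeas (f : T -> R) : Prop :=
  measurable_fun setT f /\ exists K, forall w, `|f w| <= K.

Lemma bmeas_integrable (f : T -> R) :
  bmeas f -> P.-integrable setT (EFin \o f).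
Proof.
case=> mf [K HK]; apply: measurable_bounded_integrable => //.
  by apply: le_lt_trans (probability_le1 P measurableT) (ltry 1).
exists K; split; first exact: num_real.
by move=> x Kx w _ /=; apply: le_trans (HK w) (ltW Kx).
Qed.

Lemma bmeas_cst (c : R) : bmeas (fun=> c).
Proof. by split; [exact: measurable_cst | exists `|c|]. Qed.

Lemma bmeasD (f g : T -> R) : bmeas f -> bmeas g -> bmeas (fun w => f w + g w).
Proof.
move=> [mf [K HK]] [mg [K' HK']]; split; first exact: measurable_funD.
by exists (K + K') => w; apply: le_trans (ler_normD _ _) (lerD _ _).
Qed.

Lemma bmeasM (f g : T -> R) : bmeas f -> bmeas g -> bmeas (fun w => f w * g w).
Proof.
move=> [mf [K HK]] [mg [K' HK']]; split; first exact: measurable_funM.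
by exists (K * K') => w; rewrite normrM ler_pM.
Qed.

Lemma bmeasB (f g : T -> R) : bmeas f -> bmeas g -> bmeas (fun w => f w - g w).
Proof.
move=> [mf [K HK]] [mg [K' HK']]; split; first exact: measurable_funB.
by exists (K + K') => w; apply: le_trans (ler_normB _ _) (lerD _ _).
Qed.

Lemma bmeas_max (f g : T -> R) :
  bmeas f -> bmeas g -> bmeas (fun w => Num.max (f w) (g w)).
Proof.
move=> [mf [K HK]] [mg [K' HK']]; split; first exact: measurable_maxr.
exists (K + K') => w; have := HK w; have := HK' w.
have := normr_ge0 (f w); have := normr_ge0 (g w).
by rewrite maxEle; case: ifP => _; lra.
Qed.

Lemma bmeas_lt (f g : T -> R) : measurable_fun setT f -> measurable_fun setT g ->
  bmeas (fun w => (f w < g w)%R%:R).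
Proof.
move=> mf mg; split.
  rewrite (_ : (fun w => _) = (fun w => if f w < g w then 1 else 0)); last first.
    by apply/funext => w; case: ifP.
  by apply: measurable_fun_ifT => //; exact: measurable_fun_ltr.
by exists 1 => w; case: (_ < _); rewrite ?normr1 ?normr0.
Qed.

Lemma Rint_le (f g : T -> R) : bmeas f -> bmeas g -> (forall w, f w <= g w) ->
  \int[P]_w f w <= \int[P]_w g w.
Proof. by move=> bf bg fg; apply: le_Rintegral => //; exact: bmeas_integrable. Qed.

Lemma RintD (f g : T -> R) : bmeas f -> bmeas g ->
  \int[P]_w (f w + g w) = \int[P]_w f w + \int[P]_w g w.
Proof. by move=> bf bg; rewrite RintegralD //; exact: bmeas_integrable. Qed.

Lemma RintB (f g : T -> R) : bmeas f -> bmeas g ->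
  \int[P]_w (f w - g w) = \int[P]_w f w - \int[P]_w g w.
Proof. by move=> bf bg; rewrite RintegralB //; exact: bmeas_integrable. Qed.

Lemma RintZ (c : R) (f : T -> R) : bmeas f ->
  \int[P]_w (c * f w) = c * \int[P]_w f w.
Proof. by move=> bf; rewrite RintegralZl //; exact: bmeas_integrable. Qed.

Lemma Rint_cst (c : R) : \int[P]_w c = c.
Proof. by rewrite Rintegral_cst //= probability_setT mulr1. Qed.

Lemma Rint_indic (b : T -> bool) (A : set T) :
  measurable A -> (forall w, A w <-> b w) -> \int[P]_w (b w)%:R = fine (P A).
Proof.
move=> mA Ab; rewrite /Rintegral; congr fine.
transitivity (\int[P]_w (\1_A w)%:E)%E; last by rewrite integral_indic // setIT.
apply: eq_integral => w _; rewrite indicE; congr ((nat_of_bool _)%:R%:E).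
by apply/idP/idP; rewrite inE => /Ab.
Qed.

End BoundedMeasurable.

#[local] Hint Resolve bmeas_cst bmeasD bmeasB bmeasM bmeas_max bmeas_lt : core.

Lemma bmeas_measurable {R : realType} {d : measure_display} {T : measurableType d}
  (f : T -> R) : bmeas f -> measurable_fun setT f.
Proof. by case. Qed.
#[local] Hint Resolve bmeas_measurable : core.

(** * The maximum of two independent variables, one of bounded density *)

Section TwoVariables.
Context {R : realType} {d : measure_display} {T : measurableType d}.
Variable P : probability T R.
Variables (V M : T -> R) (lam : R).
Hypotheses (bV : bmeas V) (bM : bmeas M) (lam0 : 0 <= lam).
Hypothesis V_density : forall x y, x <= y ->
  \int[P]_w ((x < V w)%R%:R * (V w < y)%R%:R) <= lam * (y - x).
Hypothesis indep_slab : forall x y q,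
  \int[P]_w ((x < V w)%R%:R * (V w < y)%R%:R * (M w < q)%R%:R) =
  \int[P]_w ((x < V w)%R%:R * (V w < y)%R%:R) * \int[P]_w (M w < q)%R%:R.

Let slab (q a b : R) (w : T) : R :=
  (M w < q)%R%:R * ((a < V w - M w)%R%:R * (V w - M w < b)%R%:R).

Let bslab q a b : bmeas (slab q a b).
Proof. by rewrite /slab; auto 10. Qed.

Let bMlt q : bmeas (fun w => (M w < q)%R%:R : R).
Proof. by auto. Qed.

Let bI x y : bmeas (fun w => (x < V w)%R%:R * (V w < y)%R%:R : R).
Proof. by auto. Qed.

(** Raising [q] by [t] adds only points with q <= M < q + t; there a < V - M < b confines V to (q +
    a, q + t + b), an interval of length b - a + t, and independence splits off the probability of
    the cell of [M]. *)
Lemma slab_step (q t a b : R) : 0 <= t -> a <= b ->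
  \int[P]_w slab (q + t) a b w <=
  \int[P]_w slab q a b w + lam * (b - a + t) *
    (\int[P]_w (M w < q + t)%R%:R - \int[P]_w (M w < q)%R%:R).
Proof.
move=> t0 ab.
pose I w : R := (q + a < V w)%R%:R * (V w < q + t + b)%R%:R.
have bI' : bmeas I by apply: bI.
apply: (@le_trans _ _ (\int[P]_w (slab q a b w +
    (I w * (M w < q + t)%R%:R - I w * (M w < q)%R%:R)))).
  apply: Rint_le; [exact: bslab| by auto 10 |].
  move=> w; rewrite /slab /I.
  case: (ltP (M w) (q + t)) => h1; case: (ltP (M w) q) => h2;
  case: (ltP a (V w - M w)) => h3; case: (ltP (V w - M w) b) => h4;
  case: (ltP (q + a) (V w)) => h5; case: (ltP (V w) (q + t + b)) => h6;
  rewrite /= ?(mulr0n, mulr1n, mulr0, mul0r, mulr1, mul1r); lra.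
rewrite RintD; [|exact: bslab|by auto].
rewrite RintB; [|by auto|by auto].
rewrite !indep_slab -mulrBr lerD2l ler_wpM2r //.
  rewrite subr_ge0; apply: Rint_le => // w.
  by rewrite ler_nat; case: (ltP (M w) q) => // h; rewrite (lt_le_trans h) ?lerDl.
by apply: le_trans (V_density _ _ _) _; [lra| apply: ler_wpM2l => //; lra].
Qed.

                                                                              
                                           
(** Expresses that V - M inherits the density bound [lam] of V, also on the event M < q. The
    increments of [slab_step] telescope over a mesh of width t, and the surplus lam * t vanishes
    with t. *)
Lemma slab_le (q a b : R) : a <= b ->
  \int[P]_w slab q a b w <= lam * (b - a) * \int[P]_w (M w < q)%R%:R.
Proof.
move=> ab; have [_ [B HB]] := bM.
have below c : c <= - B -> forall w, M w < c = false.
  move=> cB w; apply/negbTE; rewrite -leNgt.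
  by have /ler_normlP[h _] := HB w; lra.
have Mq0 : 0 <= \int[P]_w (M w < q)%R%:R by apply: Rintegral_ge0.
have lamab : 0 <= lam * (b - a) by rewrite mulr_ge0 // subr_ge0.
have slab0 c : c <= - B -> \int[P]_w slab c a b w = 0.
  move=> cB; rewrite -(Rint_cst P 0); apply: eq_Rintegral => w _.
  by rewrite /slab below // mul0r.
have [qB|Bq] := leP q (- B); first by rewrite slab0 // mulr_ge0.
(* The induction starts at [- B], a lower bound of [M], where the slab is empty. *)
have iter_ (t : R) (n : nat) : 0 <= t ->
    \int[P]_w slab (- B + n%:R * t) a b w <=
    lam * (b - a + t) * \int[P]_w (M w < - B + n%:R * t)%R%:R.
  move=> t0; elim: n => [|n IH].
    rewrite mul0r addr0 slab0 // mulr_ge0 //; first by rewrite mulr_ge0 //; lra.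
    exact: Rintegral_ge0.
  rewrite (_ : - B + n.+1%:R * t = - B + n%:R * t + t); last first.
    by rewrite -natr1; ring.
  by apply: le_trans (slab_step _ _ _ _ _ _) _ => //; lra.
apply: (@le_limit_harmonic _ _ _ (lam * (q + B) * \int[P]_w (M w < q)%R%:R)) => n.
have := iter_ ((q + B) / n.+1%:R) n.+1.
rewrite [n.+1%:R * _]mulrC divfK ?pnatr_eq0 // (_ : - B + (q + B) = q); last by ring.
move=> /(_ _)/le_trans; apply; first by rewrite divr_ge0 //; lra.
by rewrite le_eqVlt; apply/orP; left; apply/eqP; field; rewrite addrC natr1 pnatr_eq0.
Qed.

Let X w := V w - M w.
Let p := \int[P]_w (0 < X w)%R%:R.
Let bX : bmeas X. Proof. by rewrite /X; auto. Qed.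
Let bXp : bmeas (fun w => (0 < X w)%R%:R : R). Proof. by auto. Qed.

(** The integrand is affine in h except where |X| <= |h|; there its deviation from the linear part
    is at most |h|, and this event has probability of order |h|. *)
Lemma smooth_max_expansion : exists C : R, forall h : R,
  `|\int[P]_w Num.max (V w + h) (M w) - \int[P]_w Num.max (V w) (M w) - h * p|
    <= C * h ^+ 2.
Proof.
have [_ [B HB]] := bM.
pose q := B + 1; have Mq w : M w < q.
  by have /ler_normlP[_ h] := HB w; rewrite /q; lra.
(* The error is at most |h| on the slab |X| < 2|h|, which has width 4|h|. The factor 2 makes the
   open slab contain |X| <= |h|. *)
exists (lam * 4) => h.
have [->|h0] := eqVneq h 0.
  rewrite mul0r subr0 expr0n mulr0.
  under eq_Rintegral do rewrite addr0.
  by rewrite subrr normr0.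
have hp : 0 < `|h| by rewrite normr_gt0.
pose D w : R := Num.max (V w + h) (M w) - Num.max (V w) (M w) - h * (0 < X w)%R%:R.
have bD : bmeas D by rewrite /D; auto 10.
have -> : \int[P]_w Num.max (V w + h) (M w) - \int[P]_w Num.max (V w) (M w) - h * p
   = \int[P]_w D w.
  by rewrite /D RintB; [rewrite RintB; [rewrite RintZ| |]| |]; auto 10.
have bS := bslab q (- (2 * `|h|)) (2 * `|h|).
have key w : `|D w| <= `|h| * slab q (- (2 * `|h|)) (2 * `|h|) w.
  rewrite /slab Mq mul1r /D /X.
  have hh1 := ler_norm h; have hh2 : - h <= `|h| by rewrite -normrN ler_norm.
  case: (ltP 0 (V w - M w)) => h1;
  case: (ltP (- (2 * `|h|)) (V w - M w)) => h3;
  case: (ltP (V w - M w) (2 * `|h|)) => h4;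
  rewrite ?maxEle; case: (leP (V w + h) (M w)) => h5; case: (leP (V w) (M w)) => h6;
  rewrite /= ?(mulr0n, mulr1n, mulr0, mul0r, mulr1, mul1r);
  rewrite ler_norml; apply/andP; split; lra.
have := slab_le q (- (2 * `|h|)) (2 * `|h|); rewrite -/q => sl.
have M1 : \int[P]_w (M w < q)%R%:R = 1.
  by rewrite -[RHS](Rint_cst P 1); apply: eq_Rintegral => w _; rewrite Mq.
have S1 : `|h| * \int[P]_w slab q (- (2 * `|h|)) (2 * `|h|) w <= lam * 4 * h ^+ 2.
  rewrite M1 mulr1 in sl.
  apply: le_trans (ler_wpM2l (ltW hp) (sl _)) _; first lra.
  rewrite -(real_normK (num_real h)); rewrite le_eqVlt; apply/orP; left; apply/eqP; ring.
rewrite -RintZ // in S1.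
rewrite ler_norml; apply/andP; split; last first.
  by apply: le_trans S1; apply: Rint_le; auto => w; apply: le_trans (ler_norm _) (key w).
rewrite lerNl; apply: le_trans S1; rewrite -mulN1r -RintZ //.
apply: Rint_le; auto => w; rewrite mulN1r.
by apply: le_trans (key w); rewrite -normrN ler_norm.
Qed.

(** This is the layer-cake formula: (s - X)^+ is the integral over u in [0,s] of 1{X < u}, and
    [slab_le] bounds the slab 0 < X < u by lam u P(M < q). The integral over u is replaced by a
    Riemann sum. *)
Lemma excess_le (q s : R) : 0 <= s ->
  \int[P]_w ((M w < q)%R%:R * ((0 < X w)%R%:R * Num.max 0 (s - X w)))
  <= lam * s ^+ 2 / 2 * \int[P]_w (M w < q)%R%:R.
Proof.
move=> s0.
pose k (u : R) w : R := (M w < q)%R%:R * ((0 < X w)%R%:R * Num.max 0 (u - X w)).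
have bk u : bmeas (k u) by rewrite /k; auto 10.
set m := \int[P]_w (M w < q)%R%:R.
have step u t : 0 <= u -> 0 <= t ->
    \int[P]_w k (u + t) w <= \int[P]_w k u w + t * (lam * (u + t) * m).
  move=> u0 t0.
  apply: (@le_trans _ _ (\int[P]_w (k u w + t * slab q 0 (u + t) w))).
    apply: Rint_le; [exact: bk | by apply: bmeasD; [exact: bk | apply: bmeasM; auto] |].
    move=> w; rewrite /k /slab -/(X w).
    case: (ltP (M w) q) => h1; case: (ltP 0 (X w)) => h2;
    case: (ltP (X w) (u + t)) => h3;
    rewrite /= ?(mulr0n, mulr1n, mulr0, mul0r, mulr1, mul1r) ?maxEle;
    case: (leP 0 (u + t - X w)) => h4; case: (leP 0 (u - X w)) => h5; lra.
  rewrite RintD; [|exact: bk|by apply: bmeasM; auto].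
  rewrite RintZ // lerD2l ler_wpM2l //.
  by have := slab_le q 0 (u + t); rewrite subr0; apply; lra.
(* Summing t * lam * (j t) * m over j = 1..n produces n(n+1)/2; with n + 1 steps of width s/(n+1)
   this exceeds s^2/2 only by s^2/(2(n+1)). *)
have iter_ t n : 0 <= t ->
    \int[P]_w k (n%:R * t) w <= lam * m * t ^+ 2 * (n%:R * (n%:R + 1) / 2).
  move=> t0; elim: n => [|n IH].
    rewrite !mul0r mulr0 -[leRHS](Rint_cst P); apply: Rint_le; auto.
    move=> w; rewrite /k sub0r; case: (ltP 0 (X w)) => h2; last by rewrite mul0r mulr0.
    by rewrite maxEle; case: (leP 0 (- X w)) => h4; rewrite ?mulr0 //; lra.
  rewrite (_ : n.+1%:R * t = n%:R * t + t); last by rewrite -natr1; ring.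
  apply: le_trans (step _ _ _ _) _ => //; first by rewrite mulr_ge0.
  apply: le_trans (lerD IH (lexx _)) _.
  by rewrite -natr1; rewrite le_eqVlt; apply/orP; left; apply/eqP; field.
apply: (@le_limit_harmonic _ _ _ (lam * m * s ^+ 2 / 2)) => n.
have := iter_ (s / n.+1%:R) n.+1.
rewrite [n.+1%:R * _]mulrC divfK ?pnatr_eq0 // => /(_ _)/le_trans; apply.
  by rewrite divr_ge0.
by rewrite le_eqVlt; apply/orP; left; apply/eqP; field; rewrite addrC natr1 pnatr_eq0.
Qed.

(** Pointwise the left side is 1{X > 0} (s - X)^+. Where M < q, [excess_le] applies; where M >= q, X
    > 0 forces V > q and the integrand is at most s. *)
Lemma bregman_slice_le (q s K : R) : 0 <= s ->
  \int[P]_w (q < V w)%R%:R <= K ->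
  \int[P]_w Num.max (V w - s) (M w) - \int[P]_w Num.max (V w) (M w) + s * p
    <= lam * s ^+ 2 / 2 * \int[P]_w (M w < q)%R%:R + s * K.
Proof.
move=> s0 VK.
have -> : \int[P]_w Num.max (V w - s) (M w) - \int[P]_w Num.max (V w) (M w) + s * p
   = \int[P]_w (Num.max (V w - s) (M w) - Num.max (V w) (M w) + s * (0 < X w)%R%:R).
  by rewrite RintD; [rewrite RintB; [rewrite RintZ| |]| |]; auto 10.
pose k w : R := (M w < q)%R%:R * ((0 < X w)%R%:R * Num.max 0 (s - X w)).
have bk : bmeas k by rewrite /k; auto 10.
apply: (@le_trans _ _ (\int[P]_w (k w + s * (q < V w)%R%:R))).
  apply: Rint_le; [by auto 10 | by auto 10|] => w.
  rewrite /k /X.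
  case: (ltP (M w) q) => h1; case: (ltP 0 (V w - M w)) => h2;
  case: (ltP q (V w)) => h3;
  rewrite /= ?(mulr0n, mulr1n, mulr0, mul0r, mulr1, mul1r) ?maxEle;
  case: (leP 0 (s - (V w - M w))) => h4;
  case: (leP (V w - s) (M w)) => h5; case: (leP (V w) (M w)) => h6; lra.
rewrite RintD; [|exact: bk| by auto 10].
rewrite RintZ; last by auto.
by apply: lerD; [exact: excess_le | exact: ler_wpM2l].
Qed.

(** The independent events V >= q and M < q together imply X > 0. *)
Lemma win_prob_ge (q e : R) : e <= \int[P]_w (q <= V w)%R%:R ->
  \int[P]_w ((q <= V w)%R%:R * (M w < q)%R%:R) =
    \int[P]_w (q <= V w)%R%:R * \int[P]_w (M w < q)%R%:R ->
  e * \int[P]_w (M w < q)%R%:R <= p.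
Proof.
move=> eV ind.
apply: le_trans (ler_wpM2r _ eV) _; first exact: Rintegral_ge0.
rewrite -ind; apply: Rint_le; auto.
  apply: bmeasM; auto.
  rewrite (_ : (fun w => _) = (fun w => 1 - (V w < q)%R%:R)); first by auto.
  by apply/funext => w; case: (leP q (V w)); rewrite ?subr0 ?subrr.
move=> w; rewrite /X; case: (leP q (V w)) => h1; case: (ltP (M w) q) => h2;
  case: (ltP 0 (V w - M w)) => h3;
  rewrite /= ?(mulr0n, mulr1n, mulr0, mul0r, mulr1, mul1r) //; lra.
Qed.

End TwoVariables.

(** * Derivatives from quadratic remainders, and finite maxima *)

(** Only |h| <= 1 is asked for, because the slice formula [pot_slice] is available only for h
    bounded below. *)
Lemma derive1_of_quadratic (R : realType) (phi : R -> R) (p C : R) :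
  (forall h, `|h| <= 1 -> `|phi h - phi 0 - h * p| <= C * h ^+ 2) ->
  derive1 phi 0 = p.
Proof.
move=> H; apply: cvg_lim => //.
apply/cvgrPdist_le => e e0.
pose r := Num.min 1 (e / (`|C| + 1)).
have C0 : 0 < `|C| + 1 by rewrite ltr_wpDl.
have r0 : 0 < r by rewrite lt_min ltr01 divr_gt0.
near=> h.
have h0 : h != 0 by near: h; exact: nbhs_dnbhs_neq.
have hr : `|h| <= r.
  by near: h; exact: dnbhs0_le.
have hp : 0 < `|h| by rewrite normr_gt0.
have h1 : `|h| <= 1 by apply: le_trans hr _; rewrite ge_min lexx.
have h2 : `|h| * (`|C| + 1) <= e.
  by rewrite -ler_pdivlMr //; apply: le_trans hr _; rewrite ge_min lexx orbT.
have -> : p - h^-1 *: (phi (h + 0) - phi 0) = - (h^-1 * (phi h - phi 0 - h * p)).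
  by rewrite addr0 /GRing.scale /=; field.
rewrite normrN normrM normfV ler_pdivrMl //.
apply: le_trans (H h h1) _.
rewrite -(real_normK (num_real h)) expr2.
have CC : C <= `|C| + 1 by have := ler_norm C; lra.
apply: (@le_trans _ _ ((`|C| + 1) * (`|h| * `|h|))).
  by apply: ler_wpM2r => //; rewrite mulr_ge0.
by rewrite mulrCA ler_pM2l // mulrC.
Unshelve. all: by end_near. Qed.

(** Once one real term [a] is present, the neutral element -oo may be replaced by any real floor
    below [a], which turns the extended maximum into a real one. *)
Lemma maxe_bigmax_EFin (R : realType) (I : Type) (r : seq I) (Q : pred I)
    (F : I -> R) (a c : R) : c <= a ->
  maxe a%:E (\big[maxe/-oo%E]_(j <- r | Q j) (F j)%:E) =
  (Num.max a (\big[Num.max/c]_(j <- r | Q j) F j))%:E.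
Proof.
move=> ca; elim: r => [|j r IH].
  by rewrite !big_nil maxeNy; congr EFin; apply/esym/max_idPl.
rewrite !big_cons; case: ifP => // _.
by rewrite maxCA IH -EFin_max maxCA.
Qed.

Lemma measurable_bigmaxr (R : realType) (d : measure_display)
    (T : measurableType d) (I : Type) (r : seq I) (Q : pred I)
    (F : I -> T -> R) (c : R) : (forall j, measurable_fun setT (F j)) ->
  measurable_fun setT (fun w => \big[Num.max/c]_(j <- r | Q j) F j w).
Proof.
move=> mF; elim: r => [|j r IH].
  by under eq_fun do rewrite big_nil; exact: measurable_cst.
under eq_fun do rewrite big_cons.
by case: (Q j) => //; exact: measurable_maxr.
Qed.

Lemma measurable_bool_set (d : measure_display) (T : measurableType d)
  (b : T -> bool) : measurable_fun setT b -> measurable [set w | b w].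
Proof.
move=> mb; rewrite (_ : [set w | b w] = setT `&` b @^-1` [set true]).
  exact: mb.
by rewrite setTI.
Qed.

(** * The smoothed potential along one coordinate *)

Section Potential.
Context {R : realType} {d : measure_display} {T : measurableType d}.
Variables (P : probability T R) (N : nat) (W : 'I_N -> T -> R) (L eta : R).
Hypotheses (L0 : 0 <= L) (eta0 : 0 < eta).
Hypothesis mW : forall j, measurable_fun setT (W j).
Hypothesis W01 : forall j w, 0 <= W j w <= 1.
Hypothesis W_density : forall j x y, x <= y ->
  fine (P (W j @^-1` `]x, y[)) <= L * (y - x).
Hypothesis W_indep : forall A : 'I_N -> set R, (forall i, measurable (A i)) ->
  P (\bigcap_(i in [set: 'I_N]) (W i @^-1` A i)) =
  (\prod_(i < N) P (W i @^-1` A i))%E.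
Variables (q eps : R).
Hypothesis eps01 : 0 < eps < 1.
Hypothesis q1 : q <= 1.
Hypothesis W_tail_ge : forall j, eps <= fine (P (W j @^-1` `[q, +oo[)).
Hypothesis W_tail_le : forall j, fine (P (W j @^-1` `]q, +oo[)) <= L * (1 - q).

Let Phi := smoothed_pot P (fun j w => eta * W j w).

Section Arm.
Variables (G : 'I_N -> R) (i : 'I_N) (s : R).
Hypothesis s0 : 0 <= s.
(** A floor that keeps [M] real even when there is no other arm. As W i >= 0, it stays below V + h
    for all h >= -(s + 1), which covers both h = -s and the |h| <= 1 used for the derivative. *)
Let c := G i - s - 1.
Let V w := G i + eta * W i w.
                                                                           
                                         
Let M w := \big[Num.max/c]_(j < N | j != i) (G j + eta * W j w).
Let p := \int[P]_w (0 < V w - M w)%R%:R.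

Let mF j : measurable_fun setT (fun w => G j + eta * W j w).
Proof. by apply: measurable_funD => //; exact: measurable_funM. Qed.

Let bV : bmeas V.
Proof.
split; first exact: mF.
exists (`|G i| + eta) => w; apply: le_trans (ler_normD _ _) _.
rewrite lerD2l normrM (gtr0_norm eta0); have /andP[h1 h2] := W01 i w.
by rewrite (ger0_norm h1) ler_piMr // ltW.
Qed.

Let bM : bmeas M.
Proof.
split; first exact: measurable_bigmaxr.
exists (`|c| + \sum_j `|G j| + eta) => w.
have Se0 : 0 <= \sum_j `|G j| + eta by rewrite addr_ge0 ?sumr_ge0 // ltW.
rewrite ler_norml; apply/andP; split.
  apply: (@le_trans _ _ c); last exact: bigmax_ge_id.
  apply: (@le_trans _ _ (- `|c|)); first by rewrite lerN2 -addrA lerDl.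
  by rewrite lerNl -normrN ler_norm.
apply: bigmax_le => [|j _].
  by apply: le_trans (ler_norm c) _; rewrite -addrA lerDl.
have := ler_norm (G j); have := normr_ge0 c; have /andP[h1 h2] := W01 j w.
have : eta * W j w <= eta by rewrite ler_piMr // ltW.
have : `|G j| <= \sum_j `|G j| by rewrite (bigD1 j) //= lerDl sumr_ge0.
lra.
Qed.

Lemma pot_slice (h : R) : - (s + 1) <= h ->
  Phi (fun j => G j + (if j == i then h else 0)) =
  \int[P]_w Num.max (V w + h) (M w).
Proof.
move=> hs; rewrite /Phi /smoothed_pot /Rintegral; congr fine.
apply: eq_integral => w _.
rewrite (bigD1 i) //= eqxx.
under eq_bigr => j /negbTE -> do rewrite addr0.
have /andP[h1 _] := W01 i w.
have h2 : 0 <= eta * W i w by rewrite mulr_ge0 // ltW.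
rewrite (@maxe_bigmax_EFin _ _ _ _ _ _ c); last by rewrite /c; lra.
by congr (Num.max _ _)%:E; rewrite /V; ring.
Qed.

(** Above the floor, M < y is an intersection of conditions on the single W j with j != i, so the
    product rule applies; at or below the floor the event is empty. *)
Lemma indep_rectangle (A : set R) (y : R) : measurable A ->
  P (W i @^-1` A `&` [set w | M w < y]) =
  (P (W i @^-1` A) * P [set w | (M w < y)%R])%E.
Proof.
move=> mA.
have [cy|yc] := ltP c y; last first.
  have -> : [set w | M w < y] = set0.
    apply/seteqP; split => w //=; rewrite ltNge => /negP; apply.
    by apply: le_trans yc _; exact: bigmax_ge_id.
  by rewrite setI0 measure0 mule0.
pose B (A : set R) j : set R := if j == i then A else [set x | G j + eta * x < y].
have mB (A' : set R) : measurable A' -> forall j, measurable (B A' j).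
  move=> mA' j; rewrite /B; case: ifP => // _.
  apply: measurable_bool_set; apply: measurable_fun_ltr => //.
  by apply: measurable_funD => //; exact: measurable_funM.
have BE A' : W i @^-1` A' `&` [set w | M w < y] =
    \bigcap_(j in [set: 'I_N]) (W j @^-1` B A' j).
  apply/seteqP; split => w /=.
    move=> [Aw /bigmax_ltP [_ H]] j _; rewrite /B /=; case: eqP => [->//|/eqP ji].
    exact: H.
  move=> H; split; first by have := H i I; rewrite /B /= eqxx.
  apply/bigmax_ltP; split => // j ji.
  by have := H j I; rewrite /B /= (negbTE ji).
have PE A' : measurable A' -> P (W i @^-1` A' `&` [set w | M w < y]) =
    (P (W i @^-1` A') * \prod_(j < N | j != i) P (W j @^-1` [set x | (G j + eta * x < y)%R]))%E.
  move=> mA'; rewrite BE W_indep; last exact: mB.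
  rewrite (bigD1 i) //= {1}/B eqxx; congr (_ * _)%E.
  by apply: eq_bigr => j ji; rewrite /B (negbTE ji).
rewrite PE //; congr (_ * _)%E.
(* Taking the whole line for arm [i] identifies the remaining product as P(M < y). *)
have := PE setT measurableT.
by rewrite preimage_setT setTI probability_setT mul1e.
Qed.

Lemma indep_Rint (a : R -> bool) (y : R) : measurable_fun setT a ->
  \int[P]_w ((a (W i w))%:R * (M w < y)%R%:R) =
  \int[P]_w (a (W i w))%:R * \int[P]_w (M w < y)%R%:R.
Proof.
move=> ma.
have mA : measurable [set x | a x] by exact: measurable_bool_set.
have mAi : measurable (W i @^-1` [set x | a x]).
  by rewrite -[X in measurable X]setTI; exact: mW.
have mM : measurable [set w | M w < y].
  by apply: measurable_bool_set; apply: measurable_fun_ltr => //; case: bM.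
rewrite (@Rint_indic _ _ _ _ (fun w => M w < y) _ mM) //.
rewrite (@Rint_indic _ _ _ _ (fun w => a (W i w)) _ mAi) //.
under eq_Rintegral do rewrite -natrM mulnb.
rewrite (@Rint_indic _ _ _ _ (fun w => a (W i w) && (M w < y)) _ (measurableI _ _ mAi mM)); last first.
  by move=> w /=; split => [[-> ->]|/andP].
by rewrite indep_rectangle // fineM ?fin_num_measure.
Qed.

Let mV_lt (x : R) : measurable_fun setT (fun u : R => x < G i + eta * u).
Proof.
apply: measurable_fun_ltr => //.
by apply: measurable_funD => //; exact: measurable_funM.
Qed.

Let mV_gt (x : R) : measurable_fun setT (fun u : R => G i + eta * u < x).
Proof.
apply: measurable_fun_ltr => //.
by apply: measurable_funD => //; exact: measurable_funM.
Qed.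

Let indep_slab (x y z : R) :
  \int[P]_w ((x < V w)%R%:R * (V w < y)%R%:R * (M w < z)%R%:R) =
  \int[P]_w ((x < V w)%R%:R * (V w < y)%R%:R) * \int[P]_w (M w < z)%R%:R.
Proof.
have := @indep_Rint (fun u => (x < G i + eta * u) && (G i + eta * u < y)) z.
move=> /(_ (measurable_and (mV_lt x) (mV_gt y))) H.
under eq_Rintegral do rewrite -natrM mulnb.
rewrite H; congr (_ * _); apply: eq_Rintegral => w _.
by rewrite -natrM mulnb.
Qed.

Let V_density (x y : R) : x <= y ->
  \int[P]_w ((x < V w)%R%:R * (V w < y)%R%:R) <= L / eta * (y - x).
Proof.
move=> xy; under eq_Rintegral do rewrite -natrM mulnb.
have mAi : measurable (W i @^-1` `](x - G i) / eta, (y - G i) / eta[).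
  by rewrite -[X in measurable X]setTI; exact: mW.
rewrite (@Rint_indic _ _ _ _ (fun w => (x < V w) && (V w < y)) _ mAi); last first.
  move=> w /=; rewrite in_itv /= ltr_pdivrMr // ltr_pdivlMr // /V.
  by rewrite ltrBlDl ltrBrDl mulrC.
apply: le_trans (W_density _ _ _ _) _.
  by rewrite ler_pM2r ?invr_gt0 // lerD2r.
by rewrite le_eqVlt; apply/orP; left; apply/eqP; field; rewrite gt_eqF.
Qed.

Let lam0 : 0 <= L / eta. Proof. by rewrite divr_ge0 // ltW. Qed.

Lemma grad_pot : grad Phi G i = p.
Proof.
have [C HC] := smooth_max_expansion P V M _ bV bM lam0 V_density indep_slab.
apply: (@derive1_of_quadratic _ _ _ C) => h h1.
have /ler_normlP[h2 h3] := h1.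
rewrite !pot_slice; try by have := s0; lra.
under [X in _ - X - _]eq_Rintegral do rewrite addr0.
exact: HC.
Qed.

Lemma win_prob_ge_tail : eps * \int[P]_w (M w < G i + eta * q)%R%:R <= p.
Proof.
have mge : measurable_fun setT (fun u : R => G i + eta * q <= G i + eta * u).
  apply: measurable_fun_ler => //.
  by apply: measurable_funD => //; exact: measurable_funM.
apply: win_prob_ge => //; last exact: (indep_Rint _ _ mge).
have mAi : measurable (W i @^-1` `[q, +oo[).
  by rewrite -[X in measurable X]setTI; exact: mW.
rewrite (@Rint_indic _ _ _ _ (fun w => G i + eta * q <= V w) _ mAi) //.
by move=> w /=; rewrite in_itv /= andbT lerD2l ler_pM2l.
Qed.

(** Trading P(M < G i + eta q) for grad / eps supplies the factor p that later compensates one of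
    the two factors 1/p in s^2. *)
Lemma pot_bregman_le :
  Phi (fun j => G j + (if j == i then - s else 0)) - Phi G + s * grad Phi G i
  <= L / eta * s ^+ 2 / 2 * (grad Phi G i / eps) + s * (L * (1 - q)).
Proof.
have e0 : 0 < eps by case/andP: eps01.
rewrite grad_pot.
have -> : Phi G = \int[P]_w Num.max (V w) (M w).
  rewrite (_ : G = fun j => G j + (if j == i then 0 else 0)); last first.
    by apply/funext => j; case: ifP; rewrite addr0.
  rewrite pot_slice; last by have := s0; lra.
  by apply: eq_Rintegral => w _; rewrite addr0.
rewrite pot_slice; last lra.
have mAi : measurable (W i @^-1` `]q, +oo[).
  by rewrite -[X in measurable X]setTI; exact: mW.
apply: le_trans (bregman_slice_le P V M _ bV bM lam0 V_density indep_slab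
  (G i + eta * q) s (L * (1 - q)) s0 _) _.
  rewrite (@Rint_indic _ _ _ _ (fun w => G i + eta * q < V w) _ mAi) //.
  by move=> w /=; rewrite in_itv /= andbT ltrD2l ltr_pM2l.
rewrite lerD2r; apply: ler_wpM2l.
  by rewrite mulr_ge0 // mulr_ge0 // sqr_ge0.
by rewrite ler_pdivlMr // mulrC; exact: win_prob_ge_tail.
Qed.

Lemma grad_pot_ge0 : 0 <= grad Phi G i.
Proof. by rewrite grad_pot; exact: Rintegral_ge0. Qed.

End Arm.

(** The weight p of the arm, together with the p gained in [pot_bregman_le], cancels the importance
    weights 1/p. *)
Lemma gbpa_arm_le (G gt : 'I_N -> R) (i : 'I_N) : -1 <= gt i <= 0 ->
  grad Phi G i * bregman Phi (gbpa_step Phi gt G i) G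
  <= L * (1 / (2 * eta * eps) + 1 - q).
Proof.
move=> /andP[g1 g0]; have e0 : 0 < eps by case/andP: eps01.
have r0 : 0 <= L * (1 / (2 * eta * eps)).
  by rewrite mulr_ge0 // divr_ge0 // mulr_ge0 // ?mulr_ge0 // ltW.
have r1 : 0 <= L * (1 - q) by rewrite mulr_ge0 // subr_ge0.
have -> : L * (1 / (2 * eta * eps) + 1 - q) = L * (1 / (2 * eta * eps)) + L * (1 - q).
  by ring.
(* An arm of probability zero contributes 0, whatever value the division by zero takes. *)
have := grad_pot_ge0 G i 0 (lexx _); rewrite le_eqVlt => /orP[/eqP <-|p0].
  by rewrite mul0r addr_ge0.
set p := grad Phi G i in p0 *.
pose s := - gt i / p.
have s0 : 0 <= s by rewrite divr_ge0 ?(ltW p0) // oppr_ge0.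
have sp : s * p = - gt i by rewrite divfK ?gt_eqF.
have -> : bregman Phi (gbpa_step Phi gt G i) G =
    Phi (fun j => G j + (if j == i then - s else 0)) - Phi G + s * p.
  rewrite /bregman (_ : gbpa_step Phi gt G i =
    fun j => G j + (if j == i then - s else 0)); last first.
    by apply/funext => j; rewrite /gbpa_step /s mulNr opprK.
  rewrite (bigD1 i) //= eqxx big1 => [|j /negbTE ->]; last by ring.
  by rewrite -/p; ring.
apply: le_trans (ler_wpM2l (ltW p0) (pot_bregman_le G i s s0)) _.
rewrite -/p.
(* Everything becomes a polynomial in s p = - gt i, which lies in [0,1]. *)
have -> : p * (L / eta * s ^+ 2 / 2 * (p / eps) + s * (L * (1 - q))) =
   (s * p) ^+ 2 * (L * (1 / (2 * eta * eps))) + (s * p) * (L * (1 - q)).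
  by field; rewrite !gt_eqF.
rewrite sp; apply: lerD; last by apply: ler_piMl => //; lra.
by apply: ler_piMl => //; nra.
Qed.

End Potential.

(** * Reduction to perturbations with all values in [0,1] *)

Lemma probability_setI_full (R : realType) (d : measure_display)
    (T : measurableType d) (P : probability T R) (A B : set T) :
  measurable A -> measurable B -> P A = 1%E -> P (B `&` A) = P B.
Proof.
move=> mA mB PA.
have PC : P (~` A) = 0%E by rewrite probability_setC // PA subee.
apply/eqP; rewrite eq_le; apply/andP; split.
  by apply: le_measure; rewrite ?inE //; exact: measurableI.
rewrite (measureDI P mB mA).
rewrite [X in (X + _ <= _)%E](_ : _ = 0%E) ?add0e //.
apply/eqP; rewrite eq_le measure_ge0 andbT -PC.
apply: le_measure; rewrite ?inE; [exact: measurableD|exact: measurableC|].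
by move=> w [].
Qed.

(** The support condition holds only almost surely; projecting onto [0,1] makes it hold at every
    point. *)
Definition clamp01 {R : realType} (x : R) : R := Num.min 1 (Num.max 0 x).

Lemma clamp01_itv (R : realType) (x : R) : 0 <= clamp01 x <= 1.
Proof. by rewrite /clamp01 le_min ler01 le_max lexx ge_min lexx. Qed.

Lemma clamp01_id (R : realType) (x : R) : 0 <= x <= 1 -> clamp01 x = x.
Proof. by case/andP=> x0 x1; rewrite /clamp01 max_r // min_r. Qed.

Lemma measurable_clamp01 (R : realType) : measurable_fun setT (@clamp01 R).
Proof. by apply: measurable_minr => //; exact: measurable_maxr. Qed.

Lemma smoothed_pot_ae (R : realType) (d : measure_display)
    (T : measurableType d) (P : probability T R) (N : nat)
    (W W' : 'I_N -> T -> R) :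
  (forall j, measurable_fun setT (W j)) ->
  (forall j, measurable_fun setT (W' j)) ->
  (forall j, {ae P, forall w, W j w = W' j w}) ->
  smoothed_pot P W = smoothed_pot P W'.
Proof.
move=> mW mW' WW'; apply/funext => G; rewrite /smoothed_pot; congr fine.
have mE (U : 'I_N -> T -> R) (r : seq 'I_N) :
    (forall j, measurable_fun setT (U j)) ->
    measurable_fun setT (fun w => \big[maxe/-oo%E]_(j <- r) (G j + U j w)%:E).
  move=> mU; elim: r => [|j r IH].
    by under eq_fun do rewrite big_nil; exact: measurable_cst.
  under eq_fun do rewrite big_cons.
  apply: measurable_maxe => //; apply/measurable_EFinP.
  exact: measurable_funD.
apply: ae_eq_integral; [by []|exact: mE|exact: mE|].
(* There are finitely many arms, so one null set serves them all. *)
have H : {ae P, forall w, forall j, W j w = W' j w}.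
  by apply: filter_forall => j; exact: WW'.
apply: filterS H => w H _.
by apply: eq_bigr => j _; rewrite H.
Qed.

(** * Density and quantile of the perturbation, and the sum over arms *)

Theorem theorem1 (R : realType) (d : measure_display) (T : measurableType d)
  (P : probability T R) (N : nat)
  (Z : {RV P >-> R}) (f : R -> R) (L : R)
  (W : 'I_N -> {RV P >-> R}) (eta : R)
  (Tn : nat) (g : nat -> 'I_N -> R) (t : nat) (eps : R) (arm : nat -> 'I_N) :
                                     
  measurable_fun setT f ->
  (forall x, 0 <= f x <= L) ->
  (forall A, measurable A ->
     distribution P Z A = (\int[lebesgue_measure]_(x in A) (f x)%:E)%E) ->
                                                                      
  P (Z @^-1` `[0, 1]) = 1%E ->
  sup [set z | fine (cdf Z z) = 0] = 0 ->
  inf [set z | fine (cdf Z z) = 1] = 1 ->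
                                            
  (forall i A, measurable A -> distribution P (W i) A = distribution P Z A) ->
  mutually_independent W ->
  0 < eta ->
                                                             
  (forall s i, (1 <= s <= Tn)%N -> -1 <= g s i <= 0) ->
  (1 <= t <= Tn)%N ->
  0 < eps < 1 ->
                                                                          
  history_pos (smoothed_pot P (fun i w => eta * W i w)) g arm t ->
  cond_exp_bregman (smoothed_pot P (fun i w => eta * W i w)) g arm t
  <= N%:R * L * (1 / (2 * eta * eps) + 1
                 - inf [set z | fine (cdf Z z) = 1 - eps]).
Proof.
move=> mf f0L fE Z01 _ _ WZ Windep eta0 gb tT eps01 _.
have /andP[e0 e1] := eps01.
have L0 : 0 <= L by have /andP[] := f0L 0; exact: le_trans.
have mZ (A : set R) : measurable A -> measurable (Z @^-1` A).
  by move=> mA; rewrite -[X in measurable X]setTI; exact: measurable_funPT.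
have mW j (A : set R) : measurable A -> measurable (W j @^-1` A).
  by move=> mA; rewrite -[X in measurable X]setTI; exact: measurable_funPT.
have fin (A : set T) : measurable A -> P A \is a fin_num by exact: fin_num_measure.
have I01 (B : set R) : measurable B -> P (Z @^-1` (B `&` `[0, 1])) = P (Z @^-1` B).
  by move=> mB; rewrite preimage_setI probability_setI_full //; exact: mZ.
have le_dens (A : set R) : measurable A ->
    (P (Z @^-1` A) <= L%:E * lebesgue_measure A)%E.
  move=> mA; have -> : P (Z @^-1` A) = distribution P Z A by [].
  rewrite fE // -integral_cst //; apply: ge0_le_integral => //.
  - by move=> x _; rewrite lee_fin; case/andP: (f0L x).
  - by apply/measurable_EFinP; exact: measurable_funS mf.
  - by move=> x _; rewrite lee_fin; case/andP: (f0L x).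
have pr_le (A B : set R) : measurable A -> measurable B -> A `<=` B ->
    fine (P (Z @^-1` A)) <= fine (P (Z @^-1` B)).
  move=> mA mB AB; apply: fine_le; [exact/fin/mZ|exact/fin/mZ|].
  by apply: le_measure; rewrite ?inE; [exact: mZ|exact: mZ|move=> w; exact: AB].
have dens (x y : R) : x <= y -> fine (P (Z @^-1` `]x, y[)) <= L * (y - x).
  move=> xy; rewrite -lee_fin fineK; last exact/fin/mZ.
  apply: le_trans (le_dens _ (measurable_itv _)) _.
  by rewrite lebesgue_measure_itv /= lte_fin; case: ifP => _; rewrite ?EFinM ?EFinB // mule0 mule_ge0 // lee_fin ?subr_ge0.
set q := inf _.
have cdfE (z : R) : fine (cdf Z z) = fine (P (Z @^-1` `]-oo, z])) by [].
have cdf_lt0 (z : R) : z < 0 -> fine (cdf Z z) = 0.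
  move=> z0; rewrite cdfE -I01 // (_ : _ `&` _ = set0) ?preimage_set0 ?measure0 //.
  by apply/seteqP; split => x //= []; rewrite !in_itv /= => ? /andP[? ?]; clear Z01; lra.
have cdf_ge1 (z : R) : 1 <= z -> 1 <= fine (cdf Z z).
  move=> z1; rewrite -[leLHS]/(fine 1%E) -Z01 cdfE; apply: pr_le => // x /=.
  by rewrite !in_itv /= => /andP[? ?]; clear Z01; lra.
(* The level set is bounded below by 0, since F vanishes on negative reals and 1 - eps > 0; hence
   the infimum is a true lower bound. *)
have Sq (z : R) : fine (cdf Z z) = 1 - eps -> q <= z.
  move=> Fz; apply: ge_inf => //; exists 0 => y /= Fy.
  by rewrite leNgt; apply/negP => /cdf_lt0; rewrite Fy; clear Z01; lra.
(* The infimum of an empty set is 0 by convention; in that case the bounds below follow from the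
   support alone. *)
have q0 : ~ (exists z, fine (cdf Z z) = 1 - eps) -> q = 0.
  move=> S0; rewrite /q (_ : mkset _ = set0) ?inf0 //.
  by apply/seteqP; split => z //= Fz; apply: S0; exists z.
have q1 : q <= 1.
  have [[z Fz]|S0] := pselect (exists z, fine (cdf Z z) = 1 - eps).
    apply: le_trans (Sq z Fz) _; rewrite leNgt; apply/negP => z1.
    by have := cdf_ge1 z (ltW z1); rewrite Fz; clear Z01; lra.
  by rewrite q0.
(* If F(z) = 1 - eps then q <= z, so Z < q implies Z <= z. *)
have below_q : fine (P (Z @^-1` `]-oo, q[)) <= 1 - eps.
  have [[z Fz]|S0] := pselect (exists z, fine (cdf Z z) = 1 - eps).
    rewrite -Fz cdfE; apply: pr_le => // x /=; rewrite !in_itv /= => xq.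
    by apply: le_trans (ltW xq) (Sq z Fz).
  rewrite q0 // -I01 // (_ : _ `&` _ = set0) ?preimage_set0 ?measure0 /=; first by clear Z01; lra.
  by apply/seteqP; split => x //= []; rewrite !in_itv /= => ? /andP[? ?]; clear Z01; lra.
have tail_ge : eps <= fine (P (Z @^-1` `[q, +oo[)).
  have -> : Z @^-1` `[q, +oo[ = ~` (Z @^-1` `]-oo, q[).
    apply/seteqP; split => w /=; rewrite !in_itv /= andbT.
      by rewrite leNgt => /negP.
    by move/negP; rewrite leNgt.
  rewrite probability_setC; last exact: mZ.
  rewrite fineB //; last exact/fin/mZ.
  by rewrite /=; clear Z01; lra.
have tail_le : fine (P (Z @^-1` `]q, +oo[)) <= L * (1 - q).
  rewrite -I01 //.
  rewrite -lee_fin fineK; last by apply/fin/mZ; exact: measurableI.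
  apply: (@le_trans _ _ (P (Z @^-1` `]q, 1]))).
    apply: le_measure; rewrite ?inE; [by apply: mZ; exact: measurableI|exact: mZ|].
    by move=> w /= []; rewrite !in_itv /= andbT => -> /andP[].
  apply: le_trans (le_dens _ (measurable_itv _)) _.
  by rewrite lebesgue_measure_itv /= lte_fin; case: ifP => _; rewrite ?EFinM ?EFinB // mule0 mule_ge0 // lee_fin ?subr_ge0.
                                                                               
(* [U] agrees with [W] almost surely, so the potential is unchanged, and it keeps the law of [Z] and
   the independence. *)
pose U j w := clamp01 (W j w).
have mU j : measurable_fun setT (U j).
  by apply: measurableT_comp; [exact: measurable_clamp01|exact: measurable_funPT].
have PU j (A : set R) : measurable A -> P (U j @^-1` A) = P (Z @^-1` A).
  move=> mA; have mcA : measurable (@clamp01 R @^-1` A).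
    by rewrite -[X in measurable X]setTI; exact: measurable_clamp01.
  transitivity (P (Z @^-1` (@clamp01 R @^-1` A))); first exact: (WZ j _ mcA).
  (* Inside [0,1], which carries all the mass, the projection is the identity. *)
  rewrite -I01 // -[RHS]I01 //; congr (P (Z @^-1` _)).
  by apply/seteqP; split => x /= [Ax]; rewrite in_itv /= => x01; split => //;
    move: Ax; rewrite clamp01_id.
have UW j : {ae P, forall w, eta * W j w = eta * U j w}.
  exists (~` (W j @^-1` `[0, 1])); split; first by apply: measurableC; exact: mW.
    rewrite probability_setC; last exact: mW.
    have -> : P (W j @^-1` `[0, 1]) = P (Z @^-1` `[0, 1]) by exact: (WZ j).
    by rewrite Z01 subee.
  move=> w /= H; rewrite in_itv /= => w01; apply: H.
  by rewrite /U clamp01_id.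
rewrite (@smoothed_pot_ae _ _ _ P _ _ (fun j w => eta * U j w)) //; last first.
- by move=> j; exact: measurable_funM.
- by move=> j; apply: measurable_funM => //; exact: measurable_funPT.
rewrite /cond_exp_bregman.
apply: (@le_trans _ _ (\sum_(i < N) L * (1 / (2 * eta * eps) + 1 - q))); last first.
  by rewrite sumr_const card_ord -[N%:R * L * _]mulrA [N%:R * _]mulr_natl.
apply: ler_sum => i _; apply: gbpa_arm_le => //.
- by move=> j w; exact: clamp01_itv.
- by move=> j x y xy; rewrite PU //; exact: dens.
- move=> A mA.
  have mcA j : measurable (@clamp01 R @^-1` A j).
    by rewrite -[X in measurable X]setTI; exact: measurable_clamp01.
  exact: (Windep (fun j => @clamp01 R @^-1` A j) mcA).
- by move=> j; rewrite PU.
- by move=> j; rewrite PU.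
- exact: gb.
Qed.
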